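(* $$-\frac{\sqrt3}{2}=\sum_{j=0}^{\infty}\left(-\frac14\right)^{j}\frac{\left(\frac1{12}\right)_j\left(\frac16\right)_j\left(\frac7{12}\right)_j}{\left(-\frac23\right)_j\left(\frac13\right)_j(1)_j}\,(60j-1).$$
   Context: $(x)_0=1$ and $(x)_j=x(x+1)\cdots(x+j-1)$ for positive integers $j$ (rising factorial). *)

(* Defs.v *)
From Stdlib Require Import Reals.
Open Scope R_scope.

(** Rising factorial [x (x + 1) ... (x + j - 1)], with value 1 at [j = 0]. *)
Fixpoint rising (x : R) (j : nat) : R :=
  match j with
  | O => 1
  | S k => rising x k * (x + INR k)
  end.

(* Main.v *)
Require Import Defs.
From Stdlib Require Import Reals.
From Coquelicot Require Import Coquelicot.
From Stdlib Require Import Lra Lia.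
Open Scope R_scope.

(** The summand is the member [m = 0] of a one-parameter family of
    hypergeometric terms [term m n] whose sums over [n] do not depend on [m].
    The parameters that move with [m] are the ones starting at [- 1 / 2],
    [- 1 / 3] and [- 2 / 3]. The independence is proved by a Wilf-Zeilberger
    pair: [term (m + 1) n - term m n] is the difference in [n] of [cert m],
    which vanishes at [n = 0] and tends to 0 ([term_cert_WZ], [cert_lim]).

    As [m] grows, everything concentrates on the index [n = 0]: the terms with
    [n >= 1] are bounded by a geometric sequence times [1 / (m + 1)]
    ([term_tail_bound]). The common sum is therefore the limit of [term m 0],
    which is [- 2 / 3] times that of
    [(- 1 / 2)_m ^ 2 / ((- 1 / 3)_m (- 2 / 3)_m)].

    This last limit is an instance of the Euler product of the cosine. With
    [I_p (a)] the integral of [cos t ^ p * cos (a t)] over [[0, PI / 2]], one has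
    [(p ^ 2 - a ^ 2) I_p (a) = p (p - 1) I_(p - 2) (a)], so along odd [p] the
    ratio [I_p (1 / 3) / I_p (0)] is a constant times the quotient of rising
    factorials above, and the constant is known from
    [I_1 (1 / 3) = 9 / 8 * cos (PI / 6)] ([base_cos_int]). The ratio tends to 1, because
    [cos t ^ 2 <= cos (t / 3) <= 1] squeezes [I_p (1 / 3)] between [I_(p + 2) (0)]
    and [I_p (0)]. The square root of 3 comes from [cos (PI / 6)]. *)

(** * A Wilf-Zeilberger pair containing the series *)

(** The four factors moving with [m] include the normalisation
    [(- 1 / 2)_m ^ 2 / ((- 1 / 3)_m (- 2 / 3)_m)] that makes the sums over [n]
    constant; it has been merged with the [n]-dependent factors, which turns
    for instance [(- 1 / 2)_m (m - 1 / 2)_n] into [(- 1 / 2)_(m + n)]. *)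
Definition base (m n : nat) : R :=
  (- 1) ^ n *
  (rising (1 / 6) (2 * n) * rising (- (1 / 6)) n * rising (1 / 6) n /
   rising 1 (2 * n)) *
  (rising (- (1 / 2)) m * rising (- (1 / 2)) (m + n) /
   (rising (- (1 / 3)) (m + 2 * n) * rising (- (2 / 3)) (m + n))).

(** At [m = 0] this is [(60 n - 1) (2 n - 1) (6 n - 1)]. The last two factors
    absorb the difference between [base 0 n / (2 n - 1 / 3)] and the
    hypergeometric part of the summand. *)
Definition cubic (m n : R) : R :=
  (2 * m - 1) + (144 * m ^ 2 - 252 * m + 68) * n
  + (576 * m - 492) * n ^ 2 + 720 * n ^ 3.

Definition term (m n : nat) : R :=
  - (base m n * cubic (INR m) (INR n)) / (3 * (INR m + 2 * INR n - 1 / 3)).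

Definition cert (m n : nat) : R :=
  - 48 * base m n * (INR n * (2 * INR n - 1)).

(** This applies to the denominator parameters [- 1 / 3] and [- 2 / 3], whose rising
    factorials never reach the value 0 although their first factor is negative. *)
Lemma nat_shift_neq0 (x : R) (k : nat) : -1 < x < 0 -> x + INR k <> 0.
Proof.
  intros Hx. destruct k as [|k].
  - simpl. lra.
  - rewrite S_INR. pose proof (pos_INR k). lra.
Qed.

Lemma rising_neq0 (x : R) (n : nat) :
  (forall k, x + INR k <> 0) -> rising x n <> 0.
Proof.
  intros Hx. induction n as [|n IH]; simpl.
  - lra.
  - apply Rmult_integral_contrapositive_currified; auto.
Qed.

Lemma rising1_neq0 (n : nat) : rising 1 n <> 0.
Proof. apply rising_neq0. intros k. pose proof (pos_INR k). lra. Qed.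

Lemma rising_neg_neq0 (x : R) (n : nat) : -1 < x < 0 -> rising x n <> 0.
Proof. intros Hx. apply rising_neq0. intros k. now apply nat_shift_neq0. Qed.

Lemma INR_2mul (n : nat) : INR (2 * n) = 2 * INR n.
Proof. now rewrite mult_INR. Qed.

Lemma denominators_neq0 (m n : nat) :
  INR m + 2 * INR n - 1 / 3 <> 0 /\ INR m + INR n - 2 / 3 <> 0.
Proof.
  rewrite <- INR_2mul, <- !plus_INR.
  pose proof (nat_shift_neq0 (- (1 / 3)) (m + 2 * n)).
  pose proof (nat_shift_neq0 (- (2 / 3)) (m + n)). lra.
Qed.

Lemma base_Sn (m n : nat) :
  base m (S n) =
  - base m n *
  ((1 / 6 + 2 * INR n) * (7 / 6 + 2 * INR n) * (INR n - 1 / 6) * (INR n + 1 / 6)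
   * (INR m + INR n - 1 / 2) /
   ((2 * INR n + 1) * (2 * INR n + 2) * (INR m + 2 * INR n - 1 / 3)
    * (INR m + 2 * INR n + 2 / 3) * (INR m + INR n - 2 / 3))).
Proof.
  destruct (denominators_neq0 m n) as [d1 d2].
  pose proof (pos_INR n). pose proof (pos_INR m).
  pose proof (rising1_neq0 (2 * n)).
  assert (rising (- (1 / 3)) (m + 2 * n) <> 0) by (apply rising_neg_neq0; lra).
  assert (rising (- (2 / 3)) (m + n) <> 0) by (apply rising_neg_neq0; lra).
  unfold base.
  replace (2 * S n)%nat with (S (S (2 * n))) by lia.
  replace (m + S (S (2 * n)))%nat with (S (S (m + 2 * n))) by lia.
  replace (m + S n)%nat with (S (m + n)) by lia.
  cbn [rising pow]. rewrite !S_INR, !plus_INR, !INR_2mul.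
  field. repeat split; lra.
Qed.

Lemma base_Sm (m n : nat) :
  base (S m) n =
  base m n * ((INR m - 1 / 2) * (INR m + INR n - 1 / 2) /
           ((INR m + 2 * INR n - 1 / 3) * (INR m + INR n - 2 / 3))).
Proof.
  destruct (denominators_neq0 m n) as [d1 d2].
  pose proof (rising1_neq0 (2 * n)).
  assert (rising (- (1 / 3)) (m + 2 * n) <> 0) by (apply rising_neg_neq0; lra).
  assert (rising (- (2 / 3)) (m + n) <> 0) by (apply rising_neg_neq0; lra).
  unfold base.
  rewrite !Nat.add_succ_l. cbn [rising].
  rewrite !plus_INR, !INR_2mul.
  field. repeat split; lra.
Qed.

(** After division by [base m n], both sides are rational functions of [m] and [n]
    by the two ratio lemmas, and the identity is checked by clearing
    denominators. *)
Lemma term_cert_WZ (m n : nat) : term (S m) n - term m n = cert m (S n) - cert m n.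
Proof.
  destruct (denominators_neq0 m n) as [d1 d2].
  pose proof (pos_INR n). pose proof (pos_INR m).
  unfold term, cert, cubic. rewrite base_Sm, base_Sn, !S_INR.
  field. repeat split; lra.
Qed.

(** The certificate telescopes, and its factor [n] kills the lower end. *)
Lemma term_partial_sum_shift (m N : nat) :
  sum_n (term m) N = sum_n (term (S m)) N - cert m (S N).
Proof.
  induction N as [|N IH].
  - rewrite !sum_O. pose proof (term_cert_WZ m 0) as E.
    assert (cert m 0 = 0) by (unfold cert; simpl; ring). lra.
  - rewrite !sum_Sn. unfold plus; simpl. rewrite IH.
    pose proof (term_cert_WZ m (S N)). lra.
Qed.

(** At [m = 0] the duplication [(x)_(2 n) = 4 ^ n (x / 2)_n ((x + 1) / 2)_n] turns the
    rising factorials of length [2 n] into shorter ones, most of which cancel;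
    what is left over is [(- 1 / 2)_n / (1 / 2)_n = 1 / (1 - 2 n)]. The proof compares
    the consecutive ratios of the two sides. *)
Lemma base_0_summand (n : nat) :
  (- (1 / 4)) ^ n *
  ((rising (1 / 12) n * rising (1 / 6) n * rising (7 / 12) n) /
   (rising (- (2 / 3)) n * rising (1 / 3) n * rising 1 n))
  = base 0 n * (1 - 2 * INR n).
Proof.
  induction n as [|n IH].
  - unfold base; simpl. field.
  - rewrite base_Sn, S_INR.
    pose proof (pos_INR n). pose proof (rising1_neq0 n).
    assert (rising (- (2 / 3)) n <> 0) by (apply rising_neg_neq0; lra).
    assert (rising (1 / 3) n <> 0)
      by (apply rising_neq0; intros k; pose proof (pos_INR k); lra).
    destruct (denominators_neq0 0 n) as [d1 d2]. simpl INR in d1, d2 |- *.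
    assert (d3 : 1 - 2 * INR n <> 0).
    { intros E. assert (E' : INR (2 * n) = INR 1) by (rewrite INR_2mul; simpl; lra).
      apply INR_eq in E'. lia. }
    assert (E : base 0 n =
      (- (1 / 4)) ^ n *
      ((rising (1 / 12) n * rising (1 / 6) n * rising (7 / 12) n) /
       (rising (- (2 / 3)) n * rising (1 / 3) n * rising 1 n)) / (1 - 2 * INR n))
      by (rewrite IH; field; exact d3).
    rewrite E. cbn [rising pow]. field. repeat split; lra.
Qed.

Lemma term_0_summand (n : nat) :
  (- (1 / 4)) ^ n *
  ((rising (1 / 12) n * rising (1 / 6) n * rising (7 / 12) n) /
   (rising (- (2 / 3)) n * rising (1 / 3) n * rising 1 n)) *
  (60 * INR n - 1) = term 0 n.
Proof.
  rewrite base_0_summand. destruct (denominators_neq0 0 n) as [d1 _].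
  unfold term, cubic. simpl INR in *. field. lra.
Qed.

(** * The limit of the first terms *)

Definition cos_int (p : nat) (a : R) : R :=
  RInt (fun t => cos t ^ p * cos (a * t)) 0 (PI / 2).

Lemma cos_int_ex (p : nat) (a : R) :
  ex_RInt (fun t => cos t ^ p * cos (a * t)) 0 (PI / 2).
Proof.
  apply (ex_RInt_continuous (V := R_CompleteNormedModule)).
  intros t _. apply (ex_derive_continuous (V := R_NormedModule)). auto_derive. auto.
Qed.

Lemma cos_int_1 (a : R) : (1 - a ^ 2) * cos_int 1 a = cos (a * (PI / 2)).
Proof.
  unfold cos_int.
  rewrite <- (RInt_scal (V := R_CompleteNormedModule)) by apply cos_int_ex.
  apply is_RInt_unique.
  evar_last.
  - apply (is_RInt_derive (V := R_CompleteNormedModule)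
      (fun t => sin t * cos (a * t) - a * (cos t * sin (a * t)))).
    + intros t _. auto_derive; [auto|]. unfold scal; simpl; unfold mult; simpl. ring.
    + intros t _. apply (ex_derive_continuous (V := R_NormedModule)).
      unfold scal; simpl; unfold mult; simpl. auto_derive. auto.
  - unfold minus, plus, opp; simpl.
    rewrite sin_PI2, cos_PI2, sin_0, cos_0, (Rmult_0_r a), sin_0. ring.
Qed.

(** The difference of the two sides is the integral of the derivative of
    [cos t ^ (p + 1) * ((p + 2) * sin t * cos (a t) - a * cos t * sin (a t))], a
    function that vanishes at 0 and at [PI / 2]. *)
Lemma cos_int_SS (p : nat) (a : R) :
  ((INR p + 2) ^ 2 - a ^ 2) * cos_int (S (S p)) a = (INR p + 2) * (INR p + 1) * cos_int p a.
Proof.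
  enough (E : is_RInt (fun t => minus
       (scal ((INR p + 2) ^ 2 - a ^ 2) (cos t ^ (S (S p)) * cos (a * t)))
       (scal ((INR p + 2) * (INR p + 1)) (cos t ^ p * cos (a * t)))) 0 (PI / 2) 0).
  { apply (is_RInt_unique (V := R_CompleteNormedModule)) in E.
    rewrite (RInt_minus (V := R_CompleteNormedModule)) in E
      by (apply (ex_RInt_scal (V := R_CompleteNormedModule)); apply cos_int_ex).
    rewrite !(RInt_scal (V := R_CompleteNormedModule)) in E by apply cos_int_ex.
    unfold minus, plus, opp, scal in E; simpl in E; unfold mult in E; simpl in E.
    unfold cos_int. simpl. lra. }
  evar_last.
  - apply (is_RInt_derive (V := R_CompleteNormedModule)
      (fun t => cos t ^ S p * ((INR p + 2) * sin t * cos (a * t)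
                               - a * (cos t * sin (a * t))))).
    + intros t _. auto_derive; [auto|].
      unfold minus, plus, opp, scal; simpl; unfold mult; simpl.
      assert (S2 : sin t * sin t = 1 - cos t * cos t)
        by (pose proof (sin2_cos2 t) as E; unfold Rsqr in E; lra).
      replace (match p with 0%nat => 1 | S _ => INR p + 1 end) with (INR p + 1)
        by (destruct p; simpl; lra).
      ring_simplify.
      replace (sin t ^ 2) with (1 - cos t * cos t) by (rewrite <- S2; ring).
      ring.
    + intros t _. apply (ex_derive_continuous (V := R_NormedModule)).
      unfold minus, plus, opp, scal; simpl; unfold mult; simpl. auto_derive. auto.
  - unfold minus, plus, opp, zero; simpl.
    rewrite cos_PI2, sin_0, (Rmult_0_r a), sin_0. ring.
Qed.

(** On [[0, PI / 2]], [cos t ^ 2 <= cos t <= cos (t / 3) <= 1]. *)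
Lemma cos_int_bounds (p : nat) :
  cos_int (S (S p)) 0 <= cos_int p (1 / 3) <= cos_int p 0.
Proof.
  pose proof PI_RGT_0 as Hpi.
  split; apply RInt_le; try apply cos_int_ex; try lra;
    intros t Ht; rewrite Rmult_0_l, cos_0, Rmult_1_r.
  - assert (c0 : 0 <= cos t) by (apply cos_ge_0; lra).
    assert (c1 : cos t <= cos (1 / 3 * t)) by (apply cos_decr_1; lra).
    pose proof (COS_bound t). pose proof (pow_le (cos t) p c0).
    replace (cos t ^ S (S p)) with (cos t ^ p * (cos t * cos t)) by (simpl; ring).
    apply Rmult_le_compat_l; nra.
  - assert (c0 : 0 <= cos t) by (apply cos_ge_0; lra).
    pose proof (COS_bound (1 / 3 * t)). pose proof (pow_le (cos t) p c0). nra.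
Qed.

Lemma cos_int_0_SSS (k : nat) :
  cos_int (S (S (S (2 * k)))) 0 =
  (2 * INR k + 2) / (2 * INR k + 3) * cos_int (S (2 * k)) 0.
Proof.
  pose proof (cos_int_SS (S (2 * k)) 0) as E.
  rewrite S_INR, INR_2mul in E. pose proof (pos_INR k).
  apply Rmult_eq_reg_l with ((2 * INR k + 1 + 2) ^ 2 - 0 ^ 2); [|nra].
  rewrite E. field. lra.
Qed.

Lemma cos_int_0_pos (k : nat) : 0 < cos_int (S (2 * k)) 0.
Proof.
  induction k as [|k IH].
  - pose proof (cos_int_1 0) as E. rewrite Rmult_0_l, cos_0 in E. simpl. lra.
  - replace (S (2 * S k)) with (S (S (S (2 * k)))) by lia.
    rewrite cos_int_0_SSS. pose proof (pos_INR k).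
    apply Rmult_lt_0_compat; [apply Rdiv_lt_0_compat; lra | exact IH].
Qed.

(** Both [base (k + 2) 0] and the quotient of the integrals at [1 / 3] and at 0 are
    multiplied by [(k + 3 / 2) ^ 2 / ((k + 4 / 3) (k + 5 / 3))] when [k] increases.
    The constant is fixed by [k = 0], where [base 2 0 = 81 / 64] and the integrals
    are [9 / 8 * cos (PI / 6)] and 1. *)
Lemma base_cos_int (k : nat) :
  base (S (S k)) 0 * cos_int (S (2 * k)) 0 * (4 * sqrt 3)
  = 9 * cos_int (S (2 * k)) (1 / 3).
Proof.
  induction k as [|k IH].
  - pose proof (cos_int_1 0) as E0. rewrite Rmult_0_l, cos_0 in E0.
    pose proof (cos_int_1 (1 / 3)) as E1.
    replace (1 / 3 * (PI / 2)) with (PI / 6) in E1 by field.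
    rewrite cos_PI6 in E1.
    replace (S (2 * 0)) with 1%nat by lia.
    replace (cos_int 1 0) with 1 by lra.
    replace (cos_int 1 (1 / 3)) with (9 / 8 * (sqrt 3 / 2)) by lra.
    unfold base; simpl. field.
  - replace (S (2 * S k)) with (S (S (S (2 * k)))) by lia.
    pose proof (cos_int_0_SSS k) as F0.
    pose proof (cos_int_SS (S (2 * k)) (1 / 3)) as E1.
    rewrite base_Sm. rewrite !S_INR, INR_2mul in *. simpl (INR 0).
    pose proof (pos_INR k) as Hk. set (x := INR k) in *.
    assert (F1 : cos_int (S (S (S (2 * k)))) (1 / 3) =
      (2 * x + 3) * (2 * x + 2) / ((2 * x + 3) ^ 2 - 1 / 9)
      * cos_int (S (2 * k)) (1 / 3)).
    { apply Rmult_eq_reg_l with ((2 * x + 1 + 2) ^ 2 - (1 / 3) ^ 2); [|nra].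
      rewrite E1. field. nra. }
    rewrite F0, F1.
    replace (cos_int (S (2 * k)) (1 / 3)) with
      (base (S (S k)) 0 * cos_int (S (2 * k)) 0 * (4 * sqrt 3) / 9) by lra.
    field. repeat split; nra.
Qed.

Lemma sqrt3_bounds : 1 < sqrt 3 < 2.
Proof.
  pose proof (sqrt_sqrt 3 ltac:(lra)). pose proof (sqrt_pos 3). split; nra.
Qed.

(** The middle expression is the quotient of the integrals at [1 / 3] and at 0, and
    the lower bound comes from the recurrence at [a = 0], which gives
    [(2 k + 2) / (2 k + 3)] for the outer quotient. *)
Lemma base_first_squeeze (k : nat) :
  1 - 1 / (INR k + 1) <= base (S (S k)) 0 * (4 * sqrt 3) / 9 <= 1.
Proof.
  pose proof (cos_int_bounds (S (2 * k))) as [B1 B2].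
  pose proof (cos_int_0_SSS k) as F0.
  pose proof (base_cos_int k) as E. pose proof (cos_int_0_pos k) as P.
  pose proof (pos_INR k) as Hk.
  set (x := INR k) in *.
  set (j := cos_int (S (2 * k)) 0) in *.
  rewrite F0 in B1.
  assert (G : base (S (S k)) 0 * (4 * sqrt 3) / 9 * j = cos_int (S (2 * k)) (1 / 3)) by lra.
  split.
  - (* The intermediate quotient exceeds the simpler lower bound by
       [(x + 2) / ((2 x + 3) (x + 1))]. *)
    apply Rle_trans with ((2 * x + 2) / (2 * x + 3)).
    + apply Rminus_le_0.
      replace ((2 * x + 2) / (2 * x + 3) - (1 - 1 / (x + 1)))
        with ((x + 2) / ((2 * x + 3) * (x + 1))) by (field; lra).
      apply Rdiv_le_0_compat; nra.
    + apply Rmult_le_reg_r with j; lra.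
  - apply Rmult_le_reg_r with j; lra.
Qed.

Lemma is_lim_seq_inv_S (c : R) : is_lim_seq (fun k => c / (INR k + 1)) 0.
Proof.
  apply is_lim_seq_ext with (fun k => c * / INR (S k)).
  - intros k. now rewrite S_INR.
  - replace (Finite 0) with (Rbar_mult c 0) by (simpl; now rewrite Rmult_0_r).
    apply is_lim_seq_scal_l.
    apply (is_lim_seq_incr_1 (fun k => / INR k)).
    replace (Finite 0) with (Rbar_inv p_infty) by reflexivity.
    apply is_lim_seq_inv; [apply is_lim_seq_INR | discriminate].
Qed.

Lemma base_first_lim : is_lim_seq (fun m => base m 0) (9 / (4 * sqrt 3)).
Proof.
  pose proof sqrt3_bounds.
  apply is_lim_seq_incr_1, is_lim_seq_incr_1.
  apply is_lim_seq_ext with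
    (fun k => 9 / (4 * sqrt 3) * (base (S (S k)) 0 * (4 * sqrt 3) / 9)).
  { intros k. field. lra. }
  replace (Finite (9 / (4 * sqrt 3))) with (Rbar_mult (9 / (4 * sqrt 3)) 1)
    by (simpl; now rewrite Rmult_1_r).
  apply is_lim_seq_scal_l.
  apply is_lim_seq_le_le with (fun k => 1 - 1 / (INR k + 1)) (fun _ => 1).
  - apply base_first_squeeze.
  - replace (Finite 1) with (Finite (1 - 0)) by (f_equal; ring).
    apply is_lim_seq_minus'; [apply is_lim_seq_const | apply is_lim_seq_inv_S].
  - apply is_lim_seq_const.
Qed.

Lemma term_first_lim : is_lim_seq (fun m => term m 0) (- (sqrt 3 / 2)).
Proof.
  pose proof sqrt3_bounds. pose proof (sqrt_sqrt 3 ltac:(lra)) as Sq.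
  apply is_lim_seq_incr_1.
  apply is_lim_seq_ext with
    (fun m => base (S m) 0 * (- (2 / 3) + 1 / 9 / (INR m + 2 / 3))).
  { intros m. unfold term, cubic. rewrite S_INR. simpl (INR 0).
    pose proof (pos_INR m). field. lra. }
  replace (- (sqrt 3 / 2)) with (9 / (4 * sqrt 3) * (- (2 / 3) + 0)).
  2: { apply Rmult_eq_reg_r with (sqrt 3); [|lra].
       replace (- (sqrt 3 / 2) * sqrt 3) with (- (sqrt 3 * sqrt 3) / 2) by field.
       rewrite Sq. field. lra. }
  apply is_lim_seq_mult'; [apply (is_lim_seq_incr_1 (fun m => base m 0)), base_first_lim|].
  apply is_lim_seq_plus'; [apply is_lim_seq_const|].
  apply is_lim_seq_le_le with (fun _ => 0) (fun k => 1 / (INR k + 1)).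
  - intros k. pose proof (pos_INR k). split.
    + apply Rdiv_le_0_compat; lra.
    + apply Rminus_le_0.
      replace (1 / (INR k + 1) - 1 / 9 / (INR k + 2 / 3))
        with ((8 * INR k + 5) / (9 * (INR k + 1) * (INR k + 2 / 3))) by (field; lra).
      apply Rdiv_le_0_compat; [lra | nra].
  - apply is_lim_seq_const.
  - apply is_lim_seq_inv_S.
Qed.

(** * Uniform bounds on the remaining terms *)

Lemma base_first_bound (m : nat) : 0 <= base m 0 <= 3.
Proof.
  destruct m as [|[|k]].
  { replace (base 0 0) with 1 by (unfold base; simpl; field). lra. }
  { replace (base 1 0) with (9 / 8) by (unfold base; simpl; field). lra. }
  pose proof sqrt3_bounds. pose proof (base_first_squeeze k) as [B1 B2].
  pose proof (pos_INR k).
  assert (1 / (INR k + 1) <= 1)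
    by (apply -> Rdiv_le_1; lra).
  nra.
Qed.

(** The factor [(m + 1) ^ (- 2)] gained between [n = 0] and [n = 1] is what makes the
    tail vanish for large [m]: it outweighs the growth of [cubic m n], quadratic in
    [m], divided by [m + 2 n - 1 / 3]. *)
Lemma base_second_bound (m : nat) : Rabs (base m 1) <= 1 / (INR m + 1) ^ 2.
Proof.
  rewrite base_Sn. simpl (INR 0). pose proof (base_first_bound m) as B.
  destruct m as [|m].
  - simpl (INR 0). apply Rabs_le.
    replace (- base 0 0 * _) with (- base 0 0 * (7 / 768)) by field. lra.
  - rewrite S_INR. pose proof (pos_INR m) as Hm. set (x := INR m) in *.
    set (w := base (S m) 0) in *.
    replace (- w * _) with
      (w * (7 / 2592 * (x + 1 / 2) / ((x + 2 / 3) * (x + 5 / 3) * (x + 1 / 3))))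
      by (field; lra).
    assert (E : 0 <= 7 / 2592 * (x + 1 / 2) / ((x + 2 / 3) * (x + 5 / 3) * (x + 1 / 3))
                <= 1 / 3 * (1 / (x + 1 + 1) ^ 2)).
    { split.
      - apply Rdiv_le_0_compat; [lra | repeat apply Rmult_lt_0_compat; lra].
      - apply Rminus_le_0.
        replace (_ - _) with
          ((1 / 3 * ((x + 2 / 3) * (x + 5 / 3) * (x + 1 / 3))
            - 7 / 2592 * (x + 1 / 2) * (x + 1 + 1) ^ 2) /
           ((x + 1 + 1) ^ 2 * ((x + 2 / 3) * (x + 5 / 3) * (x + 1 / 3))))
          by (field; lra).
        apply Rdiv_le_0_compat; [| repeat apply Rmult_lt_0_compat; simpl; nra].
        assert (0 <= x ^ 2) by (apply pow_le; lra).
        assert (0 <= x ^ 3) by (apply pow_le; lra). nra. }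
    rewrite Rabs_pos_eq by (apply Rmult_le_pos; lra). nra.
Qed.

(** The ratio splits into three quotients, bounded by 1, [1 / 4] and [3 / 2]. *)
Lemma base_step_bound (m n : nat) :
  Rabs (base m (S (S n))) <= 3 / 8 * Rabs (base m (S n)).
Proof.
  rewrite base_Sn, Rabs_mult, Rabs_Ropp, Rmult_comm.
  apply Rmult_le_compat_r; [apply Rabs_pos|].
  rewrite S_INR. pose proof (pos_INR m). pose proof (pos_INR n).
  set (x := INR m) in *. set (y := INR n) in *.
  assert (A1 : 0 <= (1 / 6 + 2 * (y + 1)) * (7 / 6 + 2 * (y + 1)) /
                ((2 * (y + 1) + 1) * (2 * (y + 1) + 2)) <= 1).
  { split; [apply Rdiv_le_0_compat; nra|].
    apply Rmult_le_reg_r with ((2 * (y + 1) + 1) * (2 * (y + 1) + 2)); [nra|].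
    unfold Rdiv. rewrite Rmult_assoc, Rinv_l by nra. nra. }
  assert (A2 : 0 <= (y + 1 - 1 / 6) * (y + 1 + 1 / 6) /
                ((x + 2 * (y + 1) - 1 / 3) * (x + 2 * (y + 1) + 2 / 3)) <= 1 / 4).
  { split; [apply Rdiv_le_0_compat; nra|].
    apply Rmult_le_reg_r with ((x + 2 * (y + 1) - 1 / 3) * (x + 2 * (y + 1) + 2 / 3)); [nra|].
    unfold Rdiv. rewrite (Rmult_assoc _ (/ _)), Rinv_l by nra. nra. }
  assert (A3 : 0 <= (x + (y + 1) - 1 / 2) / (x + (y + 1) - 2 / 3) <= 3 / 2).
  { split; [apply Rdiv_le_0_compat; lra|].
    apply Rmult_le_reg_r with (x + (y + 1) - 2 / 3); [lra|].
    unfold Rdiv. rewrite (Rmult_assoc _ (/ _)), Rinv_l by lra. lra. }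
  replace (_ / _) with
    ((1 / 6 + 2 * (y + 1)) * (7 / 6 + 2 * (y + 1)) /
       ((2 * (y + 1) + 1) * (2 * (y + 1) + 2)) *
     ((y + 1 - 1 / 6) * (y + 1 + 1 / 6) /
       ((x + 2 * (y + 1) - 1 / 3) * (x + 2 * (y + 1) + 2 / 3))) *
     ((x + (y + 1) - 1 / 2) / (x + (y + 1) - 2 / 3))) by (field; lra).
  set (p := _ / _) in *. set (q := (y + 1 - 1 / 6) * _ / _) in *.
  set (r := (x + _ - _) / _) in *.
  clearbody p q r.
  rewrite Rabs_pos_eq by (repeat apply Rmult_le_pos; lra).
  assert (0 <= p * q <= 1 / 4) by nra. nra.
Qed.

Lemma base_bound (m n : nat) :
  Rabs (base m (S n)) <= (3 / 8) ^ n / (INR m + 1) ^ 2.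
Proof.
  induction n as [|n IH].
  - apply base_second_bound.
  - apply Rle_trans with (1 := base_step_bound m n). simpl pow at 1. lra.
Qed.

(** This trades the polynomial growth of [cubic] in [n] for a geometric factor 2,
    so that [(3 / 8) ^ n] becomes [(3 / 4) ^ n]. *)
Lemma cube_le_pow2 (n : nat) : (INR n + 1) ^ 3 <= 8 * 2 ^ n.
Proof.
  destruct n as [|[|[|n]]]; [simpl; lra.. |].
  induction n as [|n IH]; [simpl; lra|].
  change (2 ^ S (S (S (S n)))) with (2 * 2 ^ S (S (S n))).
  rewrite (S_INR (S _)). rewrite !S_INR in *.
  pose proof (pos_INR n). nra.
Qed.

(** Expanded in powers of [m] and [n], both [2000 * ((m + 1) ^ 2 * (n + 1) ^ 3)]
    plus and minus the cubic have nonnegative coefficients. *)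
Lemma cubic_bound (m n : R) :
  0 <= m -> 0 <= n -> Rabs (cubic m (n + 1)) <= 2000 * ((m + 1) ^ 2 * (n + 1) ^ 3).
Proof.
  intros Hm Hn.
  assert (P : forall i j, 0 <= m ^ i * n ^ j)
    by (intros; apply Rmult_le_pos; apply pow_le; lra).
  unfold cubic. apply Rabs_le.
  pose proof (P 0 0)%nat. pose proof (P 0 1)%nat. pose proof (P 0 2)%nat.
  pose proof (P 0 3)%nat. pose proof (P 1 0)%nat. pose proof (P 1 1)%nat.
  pose proof (P 1 2)%nat. pose proof (P 1 3)%nat. pose proof (P 2 0)%nat.
  pose proof (P 2 1)%nat. pose proof (P 2 2)%nat. pose proof (P 2 3)%nat.
  split; lra.
Qed.

Lemma term_tail_bound (m n : nat) :
  Rabs (term m (S n)) <= 8000 / (INR m + 1) * (3 / 4) ^ n.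
Proof.
  unfold term. rewrite S_INR.
  pose proof (pos_INR m) as Hm. pose proof (pos_INR n) as Hn.
  pose proof (base_bound m n) as BW. pose proof (cubic_bound _ _ Hm Hn) as BC.
  pose proof (cube_le_pow2 n) as B2.
  set (x := INR m) in *. set (y := INR n) in *.
  unfold Rdiv at 1. rewrite Rabs_mult, Rabs_Ropp, Rabs_mult, Rabs_inv.
  rewrite (Rabs_pos_eq (3 * _)) by lra.
  assert (Q : 0 < (3 / 8) ^ n) by (apply pow_lt; lra).
  assert (E : (3 / 4) ^ n = (3 / 8) ^ n * 2 ^ n)
    by (rewrite <- Rpow_mult_distr; f_equal; field).
  apply Rle_trans with
    ((3 / 8) ^ n / (x + 1) ^ 2 * (2000 * ((x + 1) ^ 2 * (y + 1) ^ 3)) * / (2 * (x + 1))).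
  - apply Rmult_le_compat.
    + apply Rmult_le_pos; apply Rabs_pos.
    + left. apply Rinv_0_lt_compat. lra.
    + apply Rmult_le_compat; auto using Rabs_pos.
    + apply Rinv_le_contravar; lra.
  - rewrite E.
    replace (_ * / (2 * (x + 1))) with (1000 / (x + 1) * ((3 / 8) ^ n * (y + 1) ^ 3))
      by (field; lra).
    replace (8000 / (x + 1) * ((3 / 8) ^ n * 2 ^ n)) with
      (1000 / (x + 1) * ((3 / 8) ^ n * (8 * 2 ^ n))) by (field; lra).
    apply Rmult_le_compat_l; [apply Rdiv_le_0_compat; lra|].
    apply Rmult_le_compat_l; lra.
Qed.

Lemma cert_lim (m : nat) : is_lim_seq (fun n => cert m (S n)) 0.
Proof.
  apply is_lim_seq_abs_0.
  apply is_lim_seq_le_le with (fun _ => 0) (fun n => 768 * (3 / 4) ^ n).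
  - intros n. split; [apply Rabs_pos|].
    unfold cert. rewrite S_INR.
    pose proof (pos_INR m) as Hm. pose proof (pos_INR n) as Hn.
    pose proof (base_bound m n) as BW. pose proof (cube_le_pow2 n) as B2.
    set (x := INR m) in *. set (y := INR n) in *.
    rewrite Rabs_mult, Rabs_mult.
    rewrite (Rabs_left (- 48)), (Rabs_pos_eq ((y + 1) * _)) by nra.
    assert (Q : 0 < (3 / 8) ^ n) by (apply pow_lt; lra).
    assert (E : (3 / 4) ^ n = (3 / 8) ^ n * 2 ^ n)
      by (rewrite <- Rpow_mult_distr; f_equal; field).
    assert (BW' : Rabs (base m (S n)) <= (3 / 8) ^ n).
    { apply Rle_trans with (1 := BW).
      apply Rmult_le_reg_r with ((x + 1) ^ 2); [apply pow_lt; lra|].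
      unfold Rdiv. rewrite Rmult_assoc, Rinv_l by (apply pow_nonzero; lra).
      apply Rmult_le_compat_l; nra. }
    rewrite E.
    replace (768 * _) with (- - 48 * (3 / 8) ^ n * (2 * (8 * 2 ^ n))) by field.
    apply Rmult_le_compat.
    + apply Rmult_le_pos; [lra | apply Rabs_pos].
    + nra.
    + apply Rmult_le_compat_l; lra.
    + assert (0 <= y ^ 2) by (apply pow_le; lra).
      assert (0 <= y ^ 3) by (apply pow_le; lra). nra.
  - apply is_lim_seq_const.
  - replace (Finite 0) with (Rbar_mult 768 0) by (simpl; now rewrite Rmult_0_r).
    apply is_lim_seq_scal_l, is_lim_seq_geom. rewrite Rabs_pos_eq; lra.
Qed.

Lemma is_series_geom_3_4 (c : R) : is_series (fun n => c * (3 / 4) ^ n) (4 * c).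
Proof.
  replace (4 * c) with (scal c (/ (1 - 3 / 4)))
    by (unfold scal; simpl; unfold mult; simpl; field).
  apply (is_series_scal_l (V := R_NormedModule)), is_series_geom.
  rewrite Rabs_pos_eq; lra.
Qed.

(** * Summation *)

Lemma term_ex_series (m : nat) : ex_series (term m).
Proof.
  apply ex_series_incr_1.
  apply (ex_series_le (K := R_AbsRing) (V := R_CompleteNormedModule))
    with (fun n => 8000 / (INR m + 1) * (3 / 4) ^ n).
  - intros n. apply term_tail_bound.
  - eexists. apply is_series_geom_3_4.
Qed.

Lemma term_sum_shift (m : nat) : Series (term (S m)) = Series (term m).
Proof.
  symmetry. apply is_series_unique.
  change (is_lim_seq (sum_n (term m)) (Series (term (S m)))).
  apply is_lim_seq_ext with
    (fun N => sum_n (term (S m)) N - cert m (S N)).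
  - intros N. symmetry. apply term_partial_sum_shift.
  - replace (Finite (Series (term (S m)))) with (Finite (Series (term (S m)) - 0))
      by (f_equal; ring).
    apply is_lim_seq_minus'; [|apply cert_lim].
    apply (Series_correct (term (S m))), term_ex_series.
Qed.

Lemma term_sum_near_first (m : nat) :
  Rabs (Series (term m) - term m 0) <= 32000 / (INR m + 1).
Proof.
  rewrite Series_incr_1 by apply term_ex_series.
  replace (term m 0 + _ - term m 0) with (Series (fun k => term m (S k))) by ring.
  pose proof (is_series_geom_3_4 (8000 / (INR m + 1))) as G.
  pose proof (pos_INR m).
  replace (32000 / (INR m + 1)) with (4 * (8000 / (INR m + 1))) by (field; lra).
  rewrite <- (is_series_unique _ _ G).
  apply Rle_trans with (Series (fun k => Rabs (term m (S k)))).
  - apply Series_Rabs.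
    apply (ex_series_le (K := R_AbsRing) (V := R_CompleteNormedModule))
      with (fun n => 8000 / (INR m + 1) * (3 / 4) ^ n).
    + intros n. unfold norm; simpl; unfold abs; simpl.
      rewrite Rabs_Rabsolu. apply term_tail_bound.
    + eexists. apply G.
  - apply Series_le; [|eexists; apply G].
    intros n. split; [apply Rabs_pos | apply term_tail_bound].
Qed.

(** The sum over [n] of [term m n] is independent of [m] and differs from [term m 0]
    by [O (1 / m)], so it equals the limit of [term m 0]. *)
Lemma term_0_sum : Series (term 0) = - (sqrt 3 / 2).
Proof.
  assert (Const : forall m, Series (term m) = Series (term 0)).
  { induction m as [|m IH]; [reflexivity | now rewrite term_sum_shift]. }
  assert (D : is_lim_seq (fun m => Series (term 0) - term m 0) 0).
  { apply is_lim_seq_abs_0.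
    apply is_lim_seq_le_le with (fun _ => 0) (fun m => 32000 / (INR m + 1)).
    - intros m. split; [apply Rabs_pos|].
      rewrite <- (Const m). apply term_sum_near_first.
    - apply is_lim_seq_const.
    - apply is_lim_seq_inv_S. }
  assert (D' : is_lim_seq (fun m => Series (term 0) - term m 0) (Series (term 0) - - (sqrt 3 / 2)))
    by (apply is_lim_seq_minus'; [apply is_lim_seq_const | apply term_first_lim]).
  apply is_lim_seq_unique in D. apply is_lim_seq_unique in D'.
  rewrite D in D'. injection D' as D'. lra.
Qed.

Theorem mainTheorem13 :
  is_series
    (fun j : nat =>
       (- (1 / 4)) ^ j *
       ((rising (1 / 12) j * rising (1 / 6) j * rising (7 / 12) j) /
        (rising (- (2 / 3)) j * rising (1 / 3) j * rising 1 j)) *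
       (60 * INR j - 1))
    (- (sqrt 3 / 2)).
Proof.
  apply is_series_ext with (term 0).
  - intros n. symmetry. apply term_0_summand.
  - rewrite <- term_0_sum. apply Series_correct, term_ex_series.
Qed.
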